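(* $\mathbf{PP}\subseteq\mathbf{NP}^{\mathbf{MNS}}$.
   Context: For a polynomial $p$, a polynomial-time computable predicate $R$ and input $x$, write $N(x)=|\{y : |y|=p(|x|)\wedge R(x,y)\}|$. A language $L$ is in $\mathbf{PP}$ if there exist $p,R$ such that for all $x$: $x\in L\iff N(x)>2^{p(|x|)-1}$. A language $L$ is in $\mathbf{MNS}$ if there exist $p,R$ such that for all $x$: $x\in L\iff N(x)=2^t-1$ for some $t\in\{1,2,3,\dots\}$. $\mathbf{NP}^{\mathbf{MNS}}$ denotes the class of languages decided by nondeterministic polynomial-time oracle Turing machines with an oracle for some language in $\mathbf{MNS}$. *)

(* Defs.v *)
From HB Require Import structures.
From mathcomp Require Import all_boot all_order all_algebra.
Set Implicit Arguments.
Unset Strict Implicit.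
Unset Printing Implicit Defensive.

Definition language := seq bool -> Prop.

(* A tape cell holds a blank (None), an input bit, or an auxiliary symbol of
   the machine's own finite alphabet. *)
Definition cell (Gamma : Type) := option (bool + Gamma).

(* A two-way infinite tape as a zipper: [tleft] lists the cells to the left of
   the head, nearest first; all cells that are not listed are blank. *)
Record tape (Gamma : Type) := Tape {
  tleft  : seq (cell Gamma);
  tcur   : cell Gamma;
  tright : seq (cell Gamma)
}.

Variant move := MoveLeft | Stay | MoveRight.

Section Tapes.
Variable Gamma : Type.

Definition tape_of (s : seq bool) : tape Gamma :=
  let cs := [seq Some (inl b) | b <- s] in
  Tape [::] (head None cs) (behead cs).

Definition tape_write (a : cell Gamma) (t : tape Gamma) : tape Gamma :=
  Tape (tleft t) a (tright t).

Definition tape_move (m : move) (t : tape Gamma) : tape Gamma :=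
  match m with
  | MoveLeft  => Tape (behead (tleft t)) (head None (tleft t))
                      (tcur t :: tright t)
  | Stay      => t
  | MoveRight => Tape (tcur t :: tleft t) (head None (tright t))
                      (behead (tright t))
  end.

Fixpoint bits_prefix (cs : seq (cell Gamma)) : seq bool :=
  if cs is Some (inl b) :: cs' then b :: bits_prefix cs' else [::].

(* The word on a tape: the maximal run of bits starting at the head and going
   right; in particular the word on [tape_of s] is [s]. *)
Definition tape_word (t : tape Gamma) : seq bool :=
  bits_prefix (tcur t :: tright t).

End Tapes.

(* Every machine has two distinguished tapes, indexed by [inl false] and
   [inl true], and finitely many work tapes, indexed by W. *)
Notation tape_index W := (bool + W)%type.

Definition reads (W : finType) (Gamma : Type) :=
  {ffun tape_index W -> cell Gamma}.
Definition actions (W : finType) (Gamma : Type) :=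
  {ffun tape_index W -> cell Gamma * move}.

Record config (Q W : finType) (Gamma : Type) := Config {
  cstate : Q;
  ctapes : {ffun tape_index W -> tape Gamma}
}.

Section Configurations.
Variables (Q W : finType) (Gamma : Type).

Definition init_config (q : Q) (x y : seq bool) : config Q W Gamma :=
  Config q [ffun i : tape_index W =>
    match i with
    | inl false => tape_of Gamma x
    | inl true  => tape_of Gamma y
    | inr _     => tape_of Gamma [::]
    end].

Definition scanned (c : config Q W Gamma) : reads W Gamma :=
  [ffun i => tcur (ctapes c i)].

Definition perform (c : config Q W Gamma) (q : Q) (w : actions W Gamma) :
    config Q W Gamma :=
  Config q [ffun i => tape_move (w i).2 (tape_write (w i).1 (ctapes c i))].

End Configurations.

(* Deterministic multi-tape Turing machines with two input words, one on each
   distinguished tape. [tm_halt q] is [Some b] when q is a halting state with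
   answer b, and [None] when the computation goes on. *)
Record TM := {
  tm_state : finType;
  tm_work  : finType;
  tm_sym   : finType;
  tm_start : tm_state;
  tm_halt  : tm_state -> option bool;
  tm_trans : tm_state -> reads tm_work tm_sym ->
             tm_state * actions tm_work tm_sym
}.

Definition tm_config (M : TM) := config (tm_state M) (tm_work M) (tm_sym M).

Definition tm_step (M : TM) (c : tm_config M) : tm_config M :=
  if tm_halt (cstate c) is Some _ then c
  else let: (q, w) := tm_trans (cstate c) (scanned c) in perform c q w.

Definition tm_init (M : TM) (x y : seq bool) : tm_config M :=
  init_config (tm_work M) (tm_sym M) (tm_start M) x y.

Definition tm_decides_in (M : TM) (time : {poly nat})
    (R : seq bool -> seq bool -> bool) : Prop :=
  forall x y : seq bool, exists2 n : nat,
    n <= time.[(size x + size y)%N]%R &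
    tm_halt (cstate (iter n (@tm_step M) (tm_init M x y))) = Some (R x y).

Definition polytime_predicate (R : seq bool -> seq bool -> bool) : Prop :=
  exists (M : TM) (time : {poly nat}), tm_decides_in M time R.

(* Nondeterministic multi-tape oracle Turing machines: [inl false] is the input
   tape and [inl true] the query tape. [ntm_trans q r q' w] holds when, in state
   q and scanning r, the machine may perform w and enter q'. *)
Record NOTM := {
  ntm_state  : finType;
  ntm_work   : finType;
  ntm_sym    : finType;
  ntm_start  : ntm_state;
  ntm_accept : ntm_state;
  ntm_query  : ntm_state;
  ntm_yes    : ntm_state;
  ntm_no     : ntm_state;
  ntm_trans  : ntm_state -> reads ntm_work ntm_sym ->
               ntm_state -> actions ntm_work ntm_sym -> bool
}.

Definition ntm_config (M : NOTM) :=
  config (ntm_state M) (ntm_work M) (ntm_sym M).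

Definition query_word (M : NOTM) (c : ntm_config M) : seq bool :=
  tape_word (ctapes c (inl true)).

(* The accepting state is halting. A query leaves all the tapes unchanged. *)
Variant ntm_step (M : NOTM) (A : language) (c : ntm_config M) :
    ntm_config M -> Prop :=
| StepTrans q w of cstate c != ntm_accept M & cstate c != ntm_query M
    & ntm_trans (cstate c) (scanned c) q w :
    ntm_step A c (perform c q w)
| StepYes of cstate c != ntm_accept M & cstate c = ntm_query M
    & A (query_word c) :
    ntm_step A c (Config (ntm_yes M) (ctapes c))
| StepNo of cstate c != ntm_accept M & cstate c = ntm_query M
    & ~ A (query_word c) :
    ntm_step A c (Config (ntm_no M) (ctapes c)).

Inductive ntm_steps (M : NOTM) (A : language) (c : ntm_config M) :
    nat -> ntm_config M -> Prop :=
| Steps0 : ntm_steps A c 0 c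
| StepsS n c1 c2 of ntm_steps A c n c1 & ntm_step A c1 c2 :
    ntm_steps A c n.+1 c2.

Definition ntm_init (M : NOTM) (x : seq bool) : ntm_config M :=
  init_config (ntm_work M) (ntm_sym M) (ntm_start M) x [::].

Definition ntm_accepts (M : NOTM) (A : language) (x : seq bool) : Prop :=
  exists n c, ntm_steps A (ntm_init M x) n c /\ cstate c = ntm_accept M.

(* All computation paths, accepting or not, obey the time bound. *)
Definition ntm_decides_in (M : NOTM) (A : language) (time : {poly nat})
    (L : language) : Prop :=
  forall x : seq bool,
    (forall n c, ntm_steps A (ntm_init M x) n c -> n <= time.[size x]%R) /\
    (L x <-> ntm_accepts M A x).

Definition NP_oracle (C : language -> Prop) (L : language) : Prop :=
  exists2 A : language, C A &
  exists (M : NOTM) (time : {poly nat}), ntm_decides_in M A time L.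

Definition num_witnesses (p : {poly nat}) (R : seq bool -> seq bool -> bool)
    (x : seq bool) : nat :=
  #|[set y : (p.[size x]%R).-tuple bool | R x y]|.

(* N(x) > 2^(p(|x|)-1) with both sides doubled, so that the case p(|x|) = 0,
   where the bound is 1/2, is not distorted by truncated subtraction. *)
Definition PP (L : language) : Prop :=
  exists (p : {poly nat}) (R : seq bool -> seq bool -> bool),
    polytime_predicate R /\
    forall x, L x <-> 2 ^ p.[size x]%R < 2 * num_witnesses p R x.

Definition MNS (L : language) : Prop :=
  exists (p : {poly nat}) (R : seq bool -> seq bool -> bool),
    polytime_predicate R /\
    forall x, L x <-> exists2 t : nat, 1 <= t & num_witnesses p R x = 2 ^ t - 1.

(* Main.v *)
Require Import Defs.
From HB Require Import structures.
From mathcomp Require Import all_boot all_order all_algebra zify.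
Set Implicit Arguments.
Unset Strict Implicit.
Unset Printing Implicit Defensive.

(** Write P = p(|x|) and N = N(x). For a word v of P bits, read as a number,
    2 N + v = 2^(P+1) can hold only if 2 N > 2^P, and then it holds for exactly
    one v. So it suffices to guess v and to check this equation with one query.
    The query encodes (x, v); its witnesses are pairs of four tag bits and a
    word y of P bits. Two tags accept when R(x, y), one when y < v, one when
    y <> v and five always, so there are 2 N + v + 6 * 2^P - 1 witnesses.
    This lies strictly between 2^(P+2) - 1 and 2^(P+4) - 1, hence has the form
    2^t - 1 only for t = P + 3, that is, when 2 N + v = 2^(P+1).

    To emit exactly P guesses, the nondeterministic machine evaluates p by
    Horner's scheme with nested loops over unary copies of |x|. *)

(** * Tapes up to trailing blanks *)

Section TapeContents.
Variable G : Type.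
Implicit Types (t : tape G) (l r : seq (cell G)) (s : seq bool).

(** Head moves can store explicit blanks at the end of a list, so equal tapes may be listed
    differently; reading with default [None] identifies such lists. *)
Definition same_cells l r := forall k, nth None l k = nth None r k.

Definition tape_at t l r :=
  same_cells (tleft t) l /\ same_cells (tcur t :: tright t) r.

Definition bits s : seq (cell G) := [seq Some (inl b) | b <- s].

Lemma tape_at_tape_of s : tape_at (tape_of G s) [::] (bits s).
Proof. by split=> // -[|k]; case: s => [|a s] //=; rewrite nth_nil. Qed.

Lemma tape_at_cur t l r : tape_at t l r -> tcur t = head None r.
Proof. by case=> _ /(_ 0) /= ->; case: r. Qed.

Lemma same_cells_behead l r :
  same_cells l r -> same_cells (behead l) (behead r).
Proof. by move=> h k; rewrite !nth_behead. Qed.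

Lemma same_cells_cons a l r : same_cells l r -> same_cells (a :: l) (a :: r).
Proof. by move=> h [|k] /=. Qed.

Lemma same_cells_head l r : same_cells l r -> head None l = head None r.
Proof. by rewrite -!nth0. Qed.

Lemma tape_at_write a t l r :
  tape_at t l r -> tape_at (tape_write a t) l (a :: behead r).
Proof.
by case=> hl hr; split=> //=; apply: same_cells_cons (same_cells_behead hr).
Qed.

Lemma tape_at_left t l r :
  tape_at t l r ->
  tape_at (tape_move MoveLeft t) (behead l) (head None l :: r).
Proof.
case=> hl hr; split=> /=; first exact: same_cells_behead.
by rewrite (same_cells_head hl); apply: same_cells_cons.
Qed.

Lemma tape_at_right t l r :
  tape_at t l r ->
  tape_at (tape_move MoveRight t) (head None r :: l) (behead r).
Proof.
move=> h; have hc := tape_at_cur h; case: h => hl hr; split=> /=.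
  by rewrite hc; apply: same_cells_cons.
move=> k; move: (hr k.+1); rewrite nth_behead => <- /=.
by case: (tright t) k => [|a u] [|k] //=; rewrite nth_nil.
Qed.

Lemma tape_at_eq t l r l' r' :
  same_cells l l' -> same_cells r r' -> tape_at t l r -> tape_at t l' r'.
Proof. by move=> hl hr [h1 h2]; split=> k; rewrite ?h1 ?h2. Qed.

Lemma same_cells_blank : same_cells [:: None] [::].
Proof. by case=> //= k; rewrite nth_nil. Qed.

Lemma tape_write_cur t : tape_write (tcur t) t = t.
Proof. by case: t. Qed.

Lemma tape_word_at t l s : tape_at t l (bits s) -> tape_word t = s.
Proof.
case=> _; rewrite /tape_word; move: (tcur t :: _) => u.
elim: s u => [|a s IH] [|b u] h //=.
- by have := h 0 => /= ->.
- by have := h 0.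
have /= -> := h 0; congr cons; apply: IH => k; exact: (h k.+1).
Qed.

(** [fwd] serves tapes read only rightwards, where the cells behind the head no longer matter. [bwd]
    serves words built by prepending: the head waits on the blank just before the word. *)
Definition fwd (t : tape G) s := exists l, tape_at t l (bits s).
Definition bwd (t : tape G) s := tape_at t [::] (None :: bits s).

Lemma fwd_cur t s : fwd t s -> tcur t = head None (bits s).
Proof. by case=> l /tape_at_cur. Qed.

Lemma fwd_right t s : fwd t s -> fwd (tape_move MoveRight t) (behead s).
Proof.
by case=> l /tape_at_right h; exists (head None (bits s) :: l); case: s h.
Qed.

Lemma bwd_put t s b :
  bwd t s -> bwd (tape_move MoveLeft (tape_write (Some (inl b)) t)) (b :: s).
Proof. by move=> /(tape_at_write (Some (inl b)))/tape_at_left. Qed.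

End TapeContents.

Definition moved m (s : seq bool) := if m is MoveRight then behead s else s.
Definition pushed o (s : seq bool) := if o is Some b then b :: s else s.

Arguments bits {G}.

(** * Counting words *)

Fixpoint cnt (n : nat) (P : seq bool -> bool) : nat :=
  if n is k.+1 then
    cnt k (fun s => P (false :: s)) + cnt k (fun s => P (true :: s))
  else P [::].

Lemma eq_cnt n (P Q : seq bool -> bool) :
  (forall s, size s = n -> P s = Q s) -> cnt n P = cnt n Q.
Proof.
elim: n P Q => [|n IH] P Q h /=; first by rewrite h.
by congr addn; apply: IH => s hs; apply: h; rewrite /= hs.
Qed.

Lemma card_tuple_cnt n (P : seq bool -> bool) :
  #|[set y : n.-tuple bool | P y]| = cnt n P.
Proof.
transitivity (\sum_(y : n.-tuple bool) (P y : nat)).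
  rewrite cardsE -sum1_card big_mkcond /=; apply: eq_bigr => y _.
  by rewrite unfold_in; case: (P y).
elim: n P => [|n IH] P /=.
  rewrite (eq_bigr (fun _ => P [::] : nat)) => [|t _]; last first.
    by rewrite (tuple0 t).
  by rewrite sum_nat_const card_tuple expn0 mul1n.
pose h (bt : bool * n.-tuple bool) := cons_tuple bt.1 bt.2.
pose h' (t : n.+1.-tuple bool) := (thead t, behead_tuple t).
rewrite (reindex h) /=; last first.
  exists h' => [[b t]|t] _; last first.
    by apply: val_inj; case/tupleP: t => b t.
  by congr pair; apply: val_inj.
rewrite -(pair_bigA _
  (fun b (t : n.-tuple bool) => nat_of_bool (P (b :: t)))) /=.
by rewrite big_bool addnC -!IH.
Qed.

Lemma cnt_le n P : cnt n P <= 2 ^ n.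
Proof.
elim: n P => [|n IH] P /=; first by case: (P _).
by rewrite expnS mul2n -addnn leq_add.
Qed.

Lemma cnt_true n : cnt n xpredT = 2 ^ n.
Proof. by elim: n => //= n ->; rewrite expnS mul2n -addnn. Qed.

Lemma cnt_false n : cnt n xpred0 = 0.
Proof. by elim: n => //= n ->. Qed.

(** Needed because a query lists the guess with its last bit in front, so counting its witnesses
    peels off last bits first. *)
Lemma cnt_rcons n P :
  cnt n.+1 P =
  cnt n (fun s => P (rcons s false)) + cnt n (fun s => P (rcons s true)).
Proof.
elim: n P => [|n IH] P //.
rewrite -[LHS]/(cnt n.+1 (fun s => P (false :: s)) +
                cnt n.+1 (fun s => P (true :: s))).
by rewrite (IH (fun s => P (_ :: s))) (IH (fun s => P (true :: s))) addnACA.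
Qed.

(* Comparison with the most significant bit at the head; [Some true] means that
   the second word is the smaller one. *)
Definition cmp_step (a b : bool) (c : option bool) :=
  if a == b then c else Some a.

Definition cmp c (v y : seq bool) : option bool :=
  foldr (fun ab => cmp_step ab.1 ab.2) c (zip v y).

(** The binary value of [v], defined as a count because this is how many words [y] the tag testing y
    < v accepts; [rank_cons] recovers the positional formula. *)
Definition rank v := cnt (size v) (fun y => cmp None v y == Some true).

Lemma rank_cons a v : rank (a :: v) = a * 2 ^ size v + rank v.
Proof.
rewrite /rank /cmp /=; case: a; rewrite /cmp_step /=.
  by rewrite (@eq_cnt _ _ xpredT) // cnt_true mul1n.
by rewrite [X in _ + X](@eq_cnt _ _ xpred0) // cnt_false addn0.
Qed.

Lemma rank_lt v : rank v < 2 ^ size v.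
Proof.
elim: v => // a v IH; rewrite rank_cons /= expnS.
by case: a; lia.
Qed.

Lemma rank_surj n k : k < 2 ^ n -> exists2 v, size v = n & rank v = k.
Proof.
elim: n k => [|n IH] k; first by case: k => // _; exists [::].
rewrite expnS => hk; case: (ltnP k (2 ^ n)) => h.
  have [v hv <-] := IH _ h.
  by exists (false :: v); rewrite ?rank_cons /= ?hv.
have [|v hv hr] := IH (k - 2 ^ n); first by lia.
by exists (true :: v); rewrite ?rank_cons /= ?hv //; lia.
Qed.

Lemma cnt_neq v : cnt (size v) (fun y => cmp None v y != None) = 2 ^ size v - 1.
Proof.
elim: v => // a v IH /=; rewrite expnS; have := expn_gt0 2 (size v).
by rewrite /cmp /=; case: a; rewrite /cmp_step /= IH cnt_true; lia.
Qed.

Lemma horner_nat_mono (p : {poly nat}) m n :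
  m <= n -> p.[m]%R <= p.[n]%R.
Proof.
move=> h; rewrite /horner; elim: (polyseq p) => //= a s IH.
by rewrite leq_add2r leq_mul.
Qed.

(** * The oracle *)

Definition tag := (bool * bool * bool * bool)%type.

Definition decide (t : tag) (c : option bool) (r : bool) : bool :=
  match t with
  | (false, false, false, _) => r
  | (false, false, true, false) => c == Some true
  | (false, false, true, true) => c != None
  | (false, true, _, _) => true
  | (true, false, false, false) => true
  | _ => false
  end.

(** Only these two tags make [decide] depend on the value of [R]; for all others its third argument
    is arbitrary. *)
Definition tag_runs (t : tag) : bool := ~~ [|| t.1.1.1, t.1.1.2 | t.1.2].

Section OracleRelation.
Variable R : seq bool -> seq bool -> bool.

(* A query is a list of blocks [0 v_i], a separator [1] and the reversed input;
   the witness runs parallel to it. Witness bits that do not face a [v_i] must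
   be 0: free padding would multiply the number of witnesses. *)
Fixpoint scan_input t c (y x q w : seq bool) : bool :=
  match q, w with
  | [::], _ => decide t c (R x y)
  | a :: q', false :: w' => scan_input t c y (a :: x) q' w'
  | _, _ => false
  end.

Fixpoint scan_guess t c (y q w : seq bool) : bool :=
  match q, w with
  | true :: q', false :: w' => scan_input t c y [::] q' w'
  | false :: a :: q', false :: b :: w' =>
      scan_guess t (cmp_step a b c) (b :: y) q' w'
  | _, _ => false
  end.

Definition oracle_rel (q w : seq bool) : bool :=
  if w is t1 :: t2 :: t3 :: t4 :: w' then
    scan_guess (t1, t2, t3, t4) None [::] q w'
  else false.

(** The query tape is written from right to left, which puts the last guessed bit in front and
    reverses the input. *)
Definition push_guess (w v : seq bool) : seq bool :=
  foldl (fun w a => false :: a :: w) w v.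

Definition query (x v : seq bool) := push_guess (true :: rev x) v.

(** Every witness bit facing the input is forced to 0, so at most one word counts. *)
Lemma cnt_scan_input t c y x q :
  cnt (size q) (scan_input t c y x q) = decide t c (R (catrev q x) y).
Proof.
elim: q x => [|a q IH] x //=; rewrite IH.
by rewrite cnt_false addn0.
Qed.

(** One witness bit per block is free, and these bits spell [s] from its last letter. Scanning thus
    meets the least significant bits first, and [cmp_step] lets each later, more significant bit
    overrule the comparison so far. *)
Lemma cnt_scan_guess t c y x v :
  cnt (size (query x v)) (scan_guess t c y (query x v)) =
  cnt (size v) (fun s => decide t (cmp c v s) (R x (s ++ y))).
Proof.
rewrite /query; elim/last_ind: v c y => [|v a IH] c y.
  rewrite /= cnt_false addn0 size_rev.
  by rewrite -(size_rev x) cnt_scan_input /= catrevE revK cats0.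
rewrite /push_guess -cats1 foldl_cat -/(push_guess _ v) size_cat /= addn1.
rewrite cnt_rcons !IH cnt_false !addn0; congr addn; apply: eq_cnt => s hs;
  by rewrite -!cats1 /cmp zip_cat // foldr_cat -catA.
Qed.

Lemma cnt_oracle_rel x v :
  cnt (size (query x v)).+4 (oracle_rel (query x v)) =
  2 * cnt (size v) (R x) + rank v + 6 * 2 ^ size v - 1.
Proof.
rewrite /= !cnt_scan_guess /= !cnt_true !cnt_false /rank.
have eR : cnt (size v) (fun s => R x (s ++ [::])) = cnt (size v) (R x).
  by apply: eq_cnt => s _; rewrite cats0.
by rewrite eR cnt_neq; have := expn_gt0 2 (size v); lia.
Qed.

End OracleRelation.

(** After adding 1, the count lies between [6 * 2 ^ P] and [9 * 2 ^ P], where the only power of two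
    is [8 * 2 ^ P]. *)
Lemma query_count_criterion P N r :
  N <= 2 ^ P -> r < 2 ^ P ->
  (exists2 t, 1 <= t & 2 * N + r + 6 * 2 ^ P - 1 = 2 ^ t - 1) <->
  2 * N + r = 2 * 2 ^ P.
Proof.
move=> hN hr; have P0 := expn_gt0 2 P; split; last first.
  by move=> e; exists P.+3 => //; rewrite !expnS; lia.
case=> t t0 e; have t1 := expn_gt0 2 t.
have {e} e : 2 ^ t = 2 * N + r + 6 * 2 ^ P by lia.
have : t = P.+3; last by move=> et; rewrite et !expnS in e; lia.
apply/eqP; rewrite eqn_leq; apply/andP; split.
  by rewrite -ltnS -(@ltn_exp2l 2) // e !expnS; lia.
by rewrite -(@ltn_exp2l 2) // e !expnS; lia.
Qed.

(** * A deterministic machine for the oracle relation *)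

Section OracleMachine.
Variable M : TM.
Notation Q := (tm_state M).
Notation W := (tm_work M).
Notation G := (tm_sym M).

Variant phase :=
  Tag1 | Tag2 | Tag3 | Tag4 | GuessMark | GuessBit | InputBit | Finish
| Answer of bool.

Definition phase_code (f : phase) : 'I_8 + bool :=
  match f with
  | Tag1 => inl (inord 0) | Tag2 => inl (inord 1) | Tag3 => inl (inord 2)
  | Tag4 => inl (inord 3) | GuessMark => inl (inord 4)
  | GuessBit => inl (inord 5) | InputBit => inl (inord 6)
  | Finish => inl (inord 7) | Answer b => inr b
  end.

Definition phase_decode (c : 'I_8 + bool) : phase :=
  match c with
  | inl i => nth Tag1 [:: Tag1; Tag2; Tag3; Tag4; GuessMark; GuessBit;
                          InputBit; Finish] i
  | inr b => Answer b
  end.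

Lemma phase_codeK : cancel phase_code phase_decode.
Proof. by case=> //=; rewrite inordK. Qed.

HB.instance Definition _ := Finite.copy phase (can_type phase_codeK).

Definition pre_state := (phase * tag * option bool)%type.

(** All tapes of [M], its two input tapes included, become work tapes: [x] and [y] are first decoded
    onto them, then the states in [Q] run [M] there. *)
Definition om_state := (pre_state + Q)%type.
Notation OW := (bool + W)%type.

Definition put (r : reads OW G) (i : tape_index OW) (o : option bool) :
    cell G * move :=
  if o is Some b then (Some (inl b), MoveLeft) else (r i, Stay).

(* The two distinguished tapes advance by [mx] and [my]; [ox] and [oy] are bits
   prepended to the words under construction on the input tapes of [M]. *)
Definition pre_acts (r : reads OW G) (mx my : move) (ox oy : option bool) :
    actions OW G :=
  [ffun i => match i with
   | inl false => (r i, mx)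
   | inl true => (r i, my)
   | inr (inl false) => put r i ox
   | inr (inl true) => put r i oy
   | inr (inr _) => (r i, Stay)
   end].

(** Decoding leaves both heads on the blank before the word; this move puts them on the first
    letter, where [M] expects them. *)
Definition run_acts (r : reads OW G) : actions OW G :=
  [ffun i => if i is inr (inl _) then (r i, MoveRight) else (r i, Stay)].

(** The tag is a shift register: each tag bit read drops the oldest one, so four reads fill it. *)
Definition pre_trans (s : pre_state) (r : reads OW G) :
    om_state * actions OW G :=
  let: (f, t, c) := s in
  let stop b := (inl (Answer b, t, c), pre_acts r Stay Stay None None) in
  let next_tag f' :=
    if r (inl true) is Some (inl b) then
      (inl (f', (t.1.1.2, t.1.2, t.2, b), c),
       pre_acts r Stay MoveRight None None)
    else stop false in
  match f with
  | Tag1 => next_tag Tag2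
  | Tag2 => next_tag Tag3
  | Tag3 => next_tag Tag4
  | Tag4 => next_tag GuessMark
  | GuessMark =>
      match r (inl false), r (inl true) with
      | Some (inl a), Some (inl false) =>
          (inl (if a then InputBit else GuessBit, t, c),
           pre_acts r MoveRight MoveRight None None)
      | _, _ => stop false
      end
  | GuessBit =>
      match r (inl false), r (inl true) with
      | Some (inl a), Some (inl b) =>
          (inl (GuessMark, t, cmp_step a b c),
           pre_acts r MoveRight MoveRight None (Some b))
      | _, _ => stop false
      end
  | InputBit =>
      match r (inl false), r (inl true) with
      | Some (inl a), Some (inl false) =>
          (inl (InputBit, t, c),
           pre_acts r MoveRight MoveRight (Some a) None)
      | Some (inl a), _ => stop false
      | _, _ => (inl (Finish, t, c), pre_acts r Stay Stay None None)
      end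
  | Finish =>
      if tag_runs t then (inr (tm_start M), run_acts r)
      else stop (decide t c false)
  | Answer b => stop b
  end.

Definition om_trans (s : om_state) (r : reads OW G) :
    om_state * actions OW G :=
  match s with
  | inl s' => pre_trans s' r
  | inr q =>
      let: (q', w) := tm_trans q [ffun j => r (inr j)] in
      (inr q', [ffun i => match i with
                          | inl _ => (r i, Stay)
                          | inr j => w j
                          end])
  end.

Definition om_halt (s : om_state) : option bool :=
  match s with
  | inl (Answer b, _, _) => Some b
  | inl _ => None
  | inr q => tm_halt q
  end.

Definition oracle_machine : TM :=
  {| tm_state := om_state; tm_work := OW; tm_sym := G;
     tm_start := inl (Tag1, (false, false, false, false), None);
     tm_halt := om_halt; tm_trans := om_trans |}.

Notation OM := oracle_machine.

Definition same_tape (t t' : tape G) :=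
  tape_at t (tleft t') (tcur t' :: tright t').

Definition simulates (c' : tm_config OM) (c : tm_config M) :=
  cstate c' = inr (cstate c) /\
  forall j, same_tape (ctapes c' (inr j)) (ctapes c j).

Lemma same_tape_move m t t' :
  same_tape t t' -> same_tape (tape_move m t) (tape_move m t').
Proof.
case: m => //= [/tape_at_left|/tape_at_right] //.
apply: tape_at_eq => //= -[|k]; case: (tright t') => //=; by rewrite nth_nil.
Qed.

Lemma simulates_step c' c :
  simulates c' c -> simulates (tm_step c') (tm_step c).
Proof.
move=> [hs ht]; rewrite /tm_step hs /=.
case E: (tm_halt (cstate c)) => [b|] //.
have -> : [ffun j => scanned c' (inr j)] = scanned c.
  by apply/ffunP=> j; rewrite !ffunE (tape_at_cur (ht j)).
case: (tm_trans _ _) => q w; split=> //= j; rewrite !ffunE.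
exact/same_tape_move/(tape_at_write _ (ht j)).
Qed.

Lemma simulates_iter n c' c :
  simulates c' c -> simulates (iter n (@tm_step OM) c') (iter n (@tm_step M) c).
Proof.
elim: n c' c => [|n IH] c' c h //.
by rewrite !iterSr; apply/IH/simulates_step.
Qed.

Lemma simulates_halt c' c :
  simulates c' c -> tm_halt (cstate c') = tm_halt (cstate c).
Proof. by case=> ->. Qed.

(** Invariant before [M] starts: [q] and [w] are the unread parts of query and witness, [x] and [y]
    the words decoded so far. *)
Definition scanning (c : tm_config OM) (s : pre_state) (q w x y : seq bool) :=
  [/\ cstate c = inl s,
      fwd (ctapes c (inl false)) q /\ fwd (ctapes c (inl true)) w,
      bwd (ctapes c (inr (inl false))) x,
      bwd (ctapes c (inr (inl true))) y &
      forall j, tape_at (ctapes c (inr (inr j))) [::] [::] ].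

Lemma scanning_step c s q w x y s' mx my ox oy :
  scanning c s q w x y -> mx <> MoveLeft -> my <> MoveLeft ->
  perform c (inl s') (pre_acts (scanned c) mx my ox oy) = tm_step c ->
  scanning (tm_step c) s' (moved mx q) (moved my w) (pushed ox x) (pushed oy y).
Proof.
move=> [hs [hq hw] hx hy hj] hmx hmy <-; split=> //=.
- split; rewrite !ffunE /= ?ffunE tape_write_cur.
    by case: mx hmx => // _; apply: fwd_right.
  by case: my hmy => // _; apply: fwd_right.
- rewrite !ffunE /=; case: ox => [b|] /=; first exact: bwd_put.
  by rewrite ?ffunE tape_write_cur.
- rewrite !ffunE /=; case: oy => [b|] /=; first exact: bwd_put.
  by rewrite ?ffunE tape_write_cur.
- by move=> j; rewrite !ffunE /= ?ffunE tape_write_cur.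
Qed.

Definition halts_in (c : tm_config OM) n b :=
  exists2 k, k <= n & tm_halt (cstate (iter k (@tm_step OM) c)) = Some b.

Lemma halts_in_step c n b : halts_in (tm_step c) n b -> halts_in c n.+1 b.
Proof. by case=> k hk h; exists k.+1; rewrite ?iterSr. Qed.

Lemma halts_in_leq c m n b : m <= n -> halts_in c m b -> halts_in c n b.
Proof. by move=> h [k hk e]; exists k => //; apply: leq_trans h. Qed.

Lemma scanning_answer c b t d q w x y n :
  scanning c (Answer b, t, d) q w x y -> halts_in c n b.
Proof. by case=> hs _ _ _ _; exists 0; rewrite //= hs. Qed.

Lemma scanning_step_eq c s q w x y :
  scanning c s q w x y -> om_halt (inl s) = None ->
  forall s' mx my ox oy,
  (forall r : reads OW G, r (inl false) = head None (bits q) ->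
     r (inl true) = head None (bits w) ->
     pre_trans s r = (inl s', pre_acts r mx my ox oy)) ->
  mx <> MoveLeft -> my <> MoveLeft ->
  scanning (tm_step c) s' (moved mx q) (moved my w) (pushed ox x) (pushed oy y).
Proof.
move=> h hh s' mx my ox oy e hmx hmy; apply: scanning_step (h) _ _ _ => //.
case: h => hs [hq hw] _ _ _; rewrite /tm_step hs [tm_halt _]hh /= e //.
- by rewrite ffunE (fwd_cur hq).
- by rewrite ffunE (fwd_cur hw).
Qed.

Lemma scanning_stop c s q w x y b t d n :
  scanning c s q w x y -> om_halt (inl s) = None ->
  (forall r : reads OW G, r (inl false) = head None (bits q) ->
     r (inl true) = head None (bits w) ->
     pre_trans s r = (inl (Answer b, t, d), pre_acts r Stay Stay None None)) ->
  halts_in c n.+1 b.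
Proof.
move=> h hh e; apply/halts_in_step/scanning_answer.
exact: (scanning_step_eq h hh e).
Qed.

Variables (time : {poly nat}) (R : seq bool -> seq bool -> bool).
Hypothesis M_decides : tm_decides_in M time R.

Lemma halts_finish c t d q w x y :
  scanning c (Finish, t, d) q w x y ->
  halts_in c (time.[(size x + size y)%N]%R).+1 (decide t d (R x y)).
Proof.
move=> h; case runs: (tag_runs t); last first.
  have -> : decide t d (R x y) = decide t d false.
    by case: t runs {h} => [[[[] []] []] b].
  apply: (scanning_stop _ h) => // r _ _.
  by rewrite /= runs.
have -> : decide t d (R x y) = R x y by case: t runs {h} => [[[[] []] []] b].
apply: halts_in_step; have [k hk e] := M_decides x y; exists k => //.
rewrite -e; apply: simulates_halt; apply: simulates_iter.
case: h => hs _ hx hy hj; rewrite /tm_step hs /= runs; split=> //= j.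
have bwd_init u s : bwd u s -> same_tape (tape_move MoveRight u) (tape_of G s).
  move=> /tape_at_right; apply: tape_at_eq; first exact: same_cells_blank.
  by move=> [|n]; case: s => [|a s] //=; rewrite nth_nil.
rewrite !ffunE; case: j => [[]|j] /=;
  rewrite ?ffunE ?tape_write_cur; try exact: bwd_init.
by apply: tape_at_eq (hj j) => // -[|n] //=; rewrite ?nth_nil.
Qed.

(** Each pass moves a bit from [q] to [x], so the argument of [time] stays fixed. The 2 pays for
    entering and leaving [Finish]. *)
Lemma halts_scan_input c t d q w x y :
  scanning c (InputBit, t, d) q w x y ->
  halts_in c (size q + 2 + time.[(size q + size x + size y)%N]%R)
    (scan_input R t d y x q w).
Proof.
elim: q w x c => [|a q IH] w x c h.
  apply: (@halts_in_step _ (time.[(size x + size y)%N]%R).+1).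
  apply: halts_finish (_ : scanning _ _ [::] w _ _).
  apply: (scanning_step_eq h _
    (mx := Stay) (my := Stay) (ox := None) (oy := None)) => // r.
  by move=> /= ->.
have -> : size (a :: q) + size x + size y = size q + size (a :: x) + size y.
  by rewrite /= addnS.
case: w h => [|[] w] h.
- apply: (scanning_stop _ h) => // r.
  by move=> /= -> ->.
- apply: (scanning_stop _ h) => // r.
  by move=> /= -> ->.
apply: (@halts_in_step _ (size q + 2 + _)).
rewrite -[X in halts_in _ _ X]/(scan_input R t d y (a :: x) q w).
apply: IH; apply: (scanning_step_eq h _
  (mx := MoveRight) (my := MoveRight) (ox := Some a) (oy := None)) => // r.
by move=> /= -> ->.
Qed.

(** A block takes two letters of [q], hence the induction on a bound for [size q]. It adds one
    letter to [y], so the argument of [time] never grows and monotonicity of the polynomial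
    suffices. *)
Lemma halts_scan_guess c t d q w y :
  scanning c (GuessMark, t, d) q w [::] y ->
  halts_in c (size q + 3 + time.[(size q + size y)%N]%R)
    (scan_guess R t d y q w).
Proof.
have [n] := ubnP (size q); elim: n => // n IH in c d q w y *.
case: q => [|a q] hn h.
  by apply: (scanning_stop _ h) => // r /= ->.
(* A block marker and the separator must both face a witness bit 0; a 1 or a missing bit rejects at
   once. *)
have rej : (if w is false :: _ then false else true) ->
    halts_in c (size (a :: q) + 3 + time.[(size (a :: q) + size y)%N]%R) false.
  move=> hw; apply: (scanning_stop _ h) => // r /= -> ->.
  by case: w hw {h} => [|[] w].
case: w rej h => [|[] w] rej h;
  try by case: a q rej {hn h} => [] [|? ?] rej; apply: rej.
apply: (@halts_in_step _ (size q + 3 + _)).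
have {}h : scanning (tm_step c) (if a then InputBit else GuessBit, t, d)
    q w [::] y.
  by apply: (scanning_step_eq h _
    (mx := MoveRight) (my := MoveRight)
    (ox := None) (oy := None)) => // r /= -> ->.
move: (tm_step c) h => {rej}c h; case: a hn h => hn h.
  apply: halts_in_leq (halts_scan_input h); rewrite addn0.
  by apply: leq_add; [lia | apply: horner_nat_mono => /=; lia].
case: q hn h => [|a q] hn h.
  by apply: (scanning_stop _ h) => // r /= ->.
case: w h => [|b w] h.
  by apply: (scanning_stop _ h) => // r /= -> ->.
apply: (@halts_in_step _ (size q + 3 + _)).
have {}h : scanning (tm_step c) (GuessMark, t, cmp_step a b d)
    q w [::] (b :: y).
  by apply: (scanning_step_eq h _ (mx := MoveRight) (my := MoveRight)
    (ox := None) (oy := Some b)) => // r /= -> ->.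
apply: halts_in_leq (IH _ _ _ _ _ _ h); last by move: hn => /=; lia.
by apply: leq_add; [lia | apply: horner_nat_mono => /=; lia].
Qed.

Lemma scanning_init q w :
  scanning (tm_init OM q w) (Tag1, (false, false, false, false), None)
    q w [::] [::].
Proof.
split=> //=.
- by split; rewrite ffunE; exists [::]; apply: tape_at_tape_of.
- rewrite ffunE; apply: tape_at_eq (tape_at_tape_of _ _) => // -[|k] //=.
  by rewrite nth_nil.
- rewrite ffunE; apply: tape_at_eq (tape_at_tape_of _ _) => // -[|k] //=.
  by rewrite nth_nil.
- by move=> j; rewrite ffunE; apply: tape_at_tape_of.
Qed.

Lemma oracle_machine_decides :
  tm_decides_in OM ('X + 7%:P + time)%R (oracle_rel R).
Proof.
move=> q w.
(* Seven is the four tag steps plus the three extra steps of [halts_scan_guess]. *)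
suff : halts_in (tm_init OM q w) (size q + 7 + time.[size q]%R)
    (oracle_rel R q w).
  apply: halts_in_leq; rewrite !hornerD hornerX hornerC.
  by apply: leq_add; [lia | apply: horner_nat_mono; lia].
rewrite [size q + 7]addnC.
have := scanning_init q w; move: (tm_init _ _ _) => c.
pose tag_next f := match f with
  | Tag1 => Some Tag2 | Tag2 => Some Tag3 | Tag3 => Some Tag4
  | Tag4 => Some GuessMark | _ => None end.
have tag_step f f' t d b u c' :
    tag_next f = Some f' ->
    scanning c' (f, t, d) q (b :: u) [::] [::] ->
    scanning (tm_step c') (f', (t.1.1.2, t.1.2, t.2, b), d) q u [::] [::].
  move=> hf h.
  apply: (scanning_step_eq h _
    (mx := Stay) (my := MoveRight) (ox := None) (oy := None)) => //.
    by case: f hf {h}.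
  by move=> r _ /= ->; case: f hf {h} => //= -[->].
have tag_stop f t d c' n :
    tag_next f <> None ->
    scanning c' (f, t, d) q [::] [::] [::] -> halts_in c' n.+1 false.
  move=> hf h; apply: (scanning_stop _ h) => //.
    by case: f hf {h}.
  by move=> r _ /= ->; case: f hf {h}.
case: w => [|t1 w]; first by move=> h; apply: tag_stop h.
move=> /(tag_step _ Tag2) - /(_ erefl) h; apply: halts_in_step.
case: w h => [|t2 w]; first by move=> h; apply: tag_stop h.
move=> /(tag_step _ Tag3) - /(_ erefl) h; apply: halts_in_step.
case: w h => [|t3 w]; first by move=> h; apply: tag_stop h.
move=> /(tag_step _ Tag4) - /(_ erefl) h; apply: halts_in_step.
case: w h => [|t4 w]; first by move=> h; apply: tag_stop h.
move=> /(tag_step _ GuessMark) - /(_ erefl) h; apply: halts_in_step.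
apply: halts_in_leq (halts_scan_guess h).
by rewrite addn0 addnAC addnC.
Qed.

End OracleMachine.

(** * The nondeterministic machine *)

Definition move_code (m : move) : option bool :=
  match m with
  | MoveLeft => Some false | Stay => None | MoveRight => Some true
  end.

Definition move_decode (o : option bool) : move :=
  match o with
  | Some false => MoveLeft | None => Stay | Some true => MoveRight
  end.

Lemma move_codeK : cancel move_code move_decode.
Proof. by case. Qed.

HB.instance Definition _ := Finite.copy move (can_type move_codeK).

Section GuessingMachine.
Variable cs : seq nat.
Notation m := (size cs).
Notation B := (sumn cs).
Notation lvl := 'I_m.+1.
Notation G := unit.

(** Level [i] handles the coefficient [nth 0 cs i]; the extra last level stands for the exhausted
    list. The countdown of [Emit] fits in ['I_B.+1] because [B], the sum of the coefficients, bounds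
    each of them. *)
Variant gstate :=
  Copy | Emit of lvl & 'I_B.+1 | EmitMark of lvl & 'I_B.+1
| Loop of lvl | Rewind of lvl | Ask | Accept | Reject.

Definition gstate_code (q : gstate) :
    'I_4 + ((lvl * 'I_B.+1) + (lvl * 'I_B.+1)) + (lvl + lvl) :=
  match q with
  | Copy => inl (inl (inord 0)) | Ask => inl (inl (inord 1))
  | Accept => inl (inl (inord 2)) | Reject => inl (inl (inord 3))
  | Emit i j => inl (inr (inl (i, j)))
  | EmitMark i j => inl (inr (inr (i, j)))
  | Loop i => inr (inl i)
  | Rewind i => inr (inr i)
  end.

Definition gstate_decode c : gstate :=
  match c with
  | inl (inl k) => nth Copy [:: Copy; Ask; Accept; Reject] (k : 'I_4)
  | inl (inr (inl (i, j))) => Emit i j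
  | inl (inr (inr (i, j))) => EmitMark i j
  | inr (inl i) => Loop i
  | inr (inr i) => Rewind i
  end.

Lemma gstate_codeK : cancel gstate_code gstate_decode.
Proof. by case=> //=; rewrite inordK. Qed.

HB.instance Definition _ := Finite.copy gstate (can_type gstate_codeK).

Notation bit b := (Some (inl b) : cell G).

Definition enter (i : nat) : gstate := Emit (inord i) (inord (nth 0 cs i)).

Definition g_acts (r : reads lvl G) (mi : move) (qa : cell G * move)
    (la : lvl -> cell G * move) : actions lvl G :=
  [ffun t => match t with
             | inl false => (r t, mi)
             | inl true => qa
             | inr j => la j
             end].

Definition only (r : reads lvl G) (i : nat) (mv : move) (j : lvl) :
    cell G * move :=
  (r (inr j), if j == i :> nat then mv else Stay).

(* The machine copies its input, reversed, to the query tape, and a unary copy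
   of its length to each level tape. A visit of level [i] then emits [cs`_i]
   guessed bits and visits level [i.+1] once per cell of level tape [i.+1]. *)
Definition g_trans (q : gstate) (r : reads lvl G) (b : bool) :
    gstate * actions lvl G :=
  let stay := (r (inl true), Stay) in
  let keep := only r 0 Stay in
  match q with
  | Copy =>
      if r (inl false) is Some (inl a) then
        (Copy, g_acts r MoveRight (bit a, MoveLeft)
                 (fun _ => (bit true, MoveRight)))
      else (enter 0, g_acts r Stay (bit true, MoveLeft) keep)
  | Emit i j =>
      if j == 0 :> nat then
        if i < m then
          (Loop (inord i.+1), g_acts r Stay stay (only r i.+1 MoveLeft))
        else (Loop i, g_acts r Stay stay keep)
      else (EmitMark i (inord j.-1), g_acts r Stay (bit b, MoveLeft) keep)
  | EmitMark i j => (Emit i j, g_acts r Stay (bit false, MoveLeft) keep)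
  | Loop i =>
      if i == 0 :> nat then (Ask, g_acts r Stay (r (inl true), MoveRight) keep)
      else if r (inr i) is Some _ then
        (enter i, g_acts r Stay stay (only r i MoveLeft))
      else (Rewind i, g_acts r Stay stay (only r i MoveRight))
  | Rewind i =>
      if r (inr i) is Some _ then
        (Rewind i, g_acts r Stay stay (only r i MoveRight))
      else (Loop (inord i.-1), g_acts r Stay stay keep)
  | Ask | Accept | Reject => (q, g_acts r Stay stay keep)
  end.

Definition guesses (q : gstate) : bool :=
  if q is Emit _ j then j != 0 :> nat else false.

(** [Reject] gets no transition: its self-loop in [g_trans] would give paths of unbounded length. *)
Definition guessing_machine : NOTM :=
  {| ntm_state := gstate; ntm_work := lvl; ntm_sym := G;
     ntm_start := Copy; ntm_accept := Accept; ntm_query := Ask;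
     ntm_yes := Accept; ntm_no := Reject;
     ntm_trans := fun q r q' w =>
       (q != Reject) && [exists b, g_trans q r b == (q', w)] |}.

Notation GM := guessing_machine.
Notation cfg := (ntm_config GM).

(* Determinized run: the pending guesses are carried along with the
   configuration and consumed in the guessing states only. *)
Definition g_step (cg : cfg * seq bool) : cfg * seq bool :=
  let: (c, g) := cg in
  let: (q, w) := g_trans (cstate c) (scanned c) (head false g) in
  if (cstate c : gstate) is Ask then (c, g)
  else (perform c q w, if guesses (cstate c) then behead g else g).

(** The oracle has not answered yet; up to this point paths correspond to determinized runs. *)
Definition live (c : cfg) :=
  (cstate c : gstate) <> Accept /\ (cstate c : gstate) <> Reject.

Lemma g_trans_guess q r b b' : ~~ guesses q -> g_trans q r b = g_trans q r b'.
Proof. by case: q => //= i j; rewrite negbK => ->. Qed.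

Lemma g_trans_accept q r b : (g_trans q r b).1 = Accept -> q = Accept.
Proof.
case: q => //= [|i j|i|i].
- by case: (r _) => [[]|].
- by do 2?case: ifP.
- by case: ifP => // _; case: (r _).
- by case: (r _).
Qed.

(** [g] records the bits chosen along the path. The free continuation [g'] carries the induction and
    later lets an unfinished guess be completed. *)
Lemma steps_g_run A c0 n c :
  ntm_steps A c0 n c -> live c ->
  exists g, forall g', iter n g_step (c0, g ++ g') = (c, g').
Proof.
elim=> [|k c1 c2 _ IH st] lv; first by exists [::].
case: st lv IH => [q w hacc hq /andP[hrej /existsP[b /eqP e]]||];
  try by move=> _ _ _ [].
move=> lv [|g hg].
  by split=> h; [move: hacc | move: hrej]; rewrite h eqxx.
have nask : (cstate c1 : gstate) <> Ask by move=> h; move: hq; rewrite h eqxx.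
have step g1 g2 : g_trans (cstate c1) (scanned c1) (head false g1) = (q, w) ->
    (if guesses (cstate c1) then behead g1 else g1) = g2 ->
    g_step (c1, g1) = (perform c1 q w, g2).
  by move=> e1 e2; rewrite /g_step e1 e2; case: (cstate c1 : gstate) nask.
case hgs: (guesses (cstate c1)).
  exists (rcons g b) => g'; rewrite iterS cat_rcons hg; apply: step => //.
  by rewrite hgs.
exists g => g'; rewrite iterS hg; apply: step; last by rewrite hgs.
by rewrite -e; apply: g_trans_guess; rewrite hgs.
Qed.

(** The step counts may differ because the determinized run idles in [Ask]. *)
Lemma g_run_steps A c0 g n c g' :
  iter n g_step (c0, g) = (c, g') -> live c ->
  exists k, ntm_steps A c0 k c.
Proof.
elim: n c g' => [|n IH] c g'.
  by case=> <- _ _; exists 0; constructor.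
rewrite iterS; case E: (iter n g_step _) => [c1 g1].
rewrite /g_step; case e: (g_trans _ _ _) => [q w] h lv.
have [ask|nask] := eqVneq (cstate c1 : gstate) Ask.
  by move: h; rewrite ask => -[ec _]; rewrite -ec in lv *; apply: IH E lv.
have {h} h : perform c1 q w = c.
  by case: (cstate c1 : gstate) h nask => [|? ?|? ?|?|?|||] [] // _ _;
    rewrite eqxx.
have lv1 : live c1.
  case: lv; rewrite -h => lva lvr.
  by split=> hs; move: e; rewrite hs => -[hq _]; [apply: lva | apply: lvr].
have [k hk] := IH _ _ E lv1; exists k.+1; apply: StepsS hk _.
rewrite -h; apply: StepTrans => //=.
  by apply/eqP; case: lv1.
apply/andP; split; first by apply/eqP; case: lv1.
by apply/existsP; exists (head false g1); rewrite e.
Qed.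

Definition runs c g t c' g' :=
  exists2 k, k <= t & iter k g_step (c, g) = (c', g').

Lemma runs_refl c g : runs c g 0 c g.
Proof. by exists 0. Qed.

Lemma runs_step c g c1 g1 t c' g' :
  g_step (c, g) = (c1, g1) -> runs c1 g1 t c' g' -> runs c g t.+1 c' g'.
Proof. by move=> e [k hk h]; exists k.+1 => //; rewrite iterSr e. Qed.

Lemma runs_trans c g t c1 g1 t' c' g' :
  runs c g t c1 g1 -> runs c1 g1 t' c' g' -> runs c g (t + t') c' g'.
Proof.
move=> [k hk e] [k' hk' e']; exists (k' + k); first by rewrite addnC leq_add.
by rewrite iterD e.
Qed.

Lemma runs_leq c g t t' c' g' :
  t <= t' -> runs c g t c' g' -> runs c g t' c' g'.
Proof. by move=> h [k hk e]; exists k => //; apply: leq_trans h. Qed.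

Definition position := (seq (cell G) * seq (cell G))%type.

(** The input tape is left out since only [Copy] consults it. *)
Definition holds (c : cfg) (st : gstate) (w : seq bool)
    (pos : nat -> position) :=
  [/\ cstate c = st, bwd (ctapes c (inl true)) w &
      forall j : lvl, tape_at (ctapes c (inr j)) (pos j).1 (pos j).2].

Definition shift (mv : move) (p : position) : position :=
  match mv with
  | MoveLeft => (behead p.1, head None p.1 :: p.2)
  | Stay => p
  | MoveRight => (head None p.2 :: p.1, behead p.2)
  end.

Definition upd (pos : nat -> position) (i : nat) (p : position) j :=
  if j == i then p else pos j.

Lemma holds_ext c st w pos pos' :
  (forall j, same_cells (pos j).1 (pos' j).1) ->
  (forall j, same_cells (pos j).2 (pos' j).2) ->
  holds c st w pos -> holds c st w pos'.
Proof. by move=> h1 h2 [hs hq hl]; split=> // j; apply: tape_at_eq (hl j). Qed.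

Lemma holds_cur c st w pos (j : lvl) :
  holds c st w pos -> scanned c (inr j) = head None (pos j).2.
Proof. by case=> _ _ hl; rewrite ffunE (tape_at_cur (hl j)). Qed.

Definition query_act (r : reads lvl G) (o : option bool) : cell G * move :=
  if o is Some a then (bit a, MoveLeft) else (r (inl true), Stay).

Lemma holds_step c st w pos st' o i mv g :
  holds c st w pos -> st <> Ask ->
  g_trans st (scanned c) (head false g) =
    (st', g_acts (scanned c) Stay (query_act (scanned c) o)
            (only (scanned c) i mv)) ->
  exists2 c', g_step (c, g) = (c', if guesses st then behead g else g) &
    holds c' st' (pushed o w) (upd pos i (shift mv (pos i))).
Proof.
move=> [hs hq hl] hask e.
exists (perform c st' (g_acts (scanned c) Stay (query_act (scanned c) o)
                         (only (scanned c) i mv))).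
  by rewrite /g_step hs e; case: st hask {hs e}.
split=> //= [|j]; rewrite !ffunE /=.
  case: o {e} => [a|] /=; first exact: bwd_put.
  by rewrite ffunE tape_write_cur.
rewrite ffunE tape_write_cur /upd; case: eqP => [<-|_]; last exact: hl.
by case: mv {e} => //=; [apply: tape_at_left | apply: tape_at_right].
Qed.

Lemma upd_stay pos i j : upd pos i (shift Stay (pos i)) j = pos j.
Proof. by rewrite /upd; case: eqP => // ->. Qed.

Lemma holds_step_stay c st w pos st' o g :
  holds c st w pos -> st <> Ask ->
  g_trans st (scanned c) (head false g) =
    (st', g_acts (scanned c) Stay (query_act (scanned c) o)
            (only (scanned c) 0 Stay)) ->
  exists2 c', g_step (c, g) = (c', if guesses st then behead g else g) &
    holds c' st' (pushed o w) pos.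
Proof.
move=> h ha e; have [c' e' h'] := holds_step h ha e; exists c' => //.
by apply: holds_ext h' => j k; rewrite upd_stay.
Qed.

(** Two leftward writes per guess, first the bit and then its marker 0, produce one block of
    [push_guess]. *)
Lemma run_emit i a c g w pos v :
  a <= B -> size v = a ->
  holds c (Emit i (inord a)) w pos ->
  exists2 c', runs c (v ++ g) (2 * a) c' g &
    holds c' (Emit i (inord 0)) (push_guess w v) pos.
Proof.
elim: v a c w => [|b v IH] [|a] c w //= ha hv h.
  by exists c => //; apply: runs_refl.
have [//||c1 e1 h1] :=
  @holds_step_stay _ _ _ _ (EmitMark i (inord a)) (Some b) (b :: v ++ g) h.
  by rewrite /= inordK.
have [//||c2 e2 h2] :=
  @holds_step_stay _ _ _ _ (Emit i (inord a)) (Some false) (v ++ g) h1.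
  by [].
have [c' r' h'] := IH a c2 _ (ltnW ha) (succn_inj hv) h2.
exists c' => //; rewrite mulnS; apply: runs_step e1 _ => /=.
by rewrite inordK //=; apply: runs_step e2 _.
Qed.

(** * Nested loops that evaluate the polynomial *)

Section Visit.
Variable n : nat.
Notation mk := (bit true).

(** In [rest] the head is just right of the [n] marks, as [Copy] leaves it. In [before k] it stands
    on the [k]-th mark, with [k] passes to go; [before 0] is the blank left of all marks. *)
Definition rest : position := (nseq n mk, [::]).
Definition before k : position :=
  (behead (nseq k mk), head None (nseq k mk) :: nseq (n - k) mk).

Fixpoint total (l : seq nat) : nat :=
  if l is a :: l' then a + n * total l' else 0.

(** Emitting takes [2 * a] steps, entering the loop one, each of the [n] passes one besides the
    inner visit, and rewinding [n + 2]. *)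
Fixpoint visit_time (l : seq nat) : nat :=
  if l is a :: l' then 2 * a + 3 + n * (visit_time l' + 2) else 1.

Lemma run_rewind i c g w pos a b :
  0 < i -> i <= m -> a + b = n ->
  holds c (Rewind (inord i)) w (upd pos i (nseq a mk, nseq b mk)) ->
  exists2 c', runs c g b.+1 c' g &
    holds c' (Loop (inord i.-1)) w (upd pos i rest).
Proof.
move=> i0 im; elim: b a c => [|b IH] a c hab h.
  have hcur := holds_cur (inord i) h; rewrite inordK // /upd eqxx /= in hcur.
  have [//||c1 e1 h1] := @holds_step_stay _ _ _ _ (Loop (inord i.-1)) None g h.
    by rewrite /= hcur inordK.
  exists c1; first exact: runs_step e1 (runs_refl _ _).
  by rewrite addn0 in hab; rewrite /rest -hab.
have hcur := holds_cur (inord i) h; rewrite inordK // /upd eqxx /= in hcur.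
have [//||c1 e1 h1] :=
  @holds_step _ _ _ _ (Rewind (inord i)) None i MoveRight g h.
  by rewrite /= hcur inordK.
have [||c' r' h'] := IH a.+1 c1; first by rewrite addSnnS.
  apply: holds_ext h1 => j k; rewrite /upd;
    case: eqP => //= _; by rewrite eqxx.
exists c' => //; exact: runs_step e1 r'.
Qed.

(** Induction on the remaining coefficients, one nesting level each. Rewinding returns the deeper
    tapes to [rest], so a visit leaves [pos] unchanged and the level above can repeat it. *)
Lemma run_visit l i c g w pos v :
  i + size l = m -> drop i cs = l -> (forall j, i < j -> pos j = rest) ->
  size v = total l -> holds c (enter i) w pos ->
  exists2 c', runs c (v ++ g) (visit_time l) c' g &
    holds c' (Loop (inord i)) (push_guess w v) pos.
Proof.
elim: l i c g w pos v => [|a l IH] i c g w pos v hi hl hpos hv h.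
  rewrite addn0 in hi; move/eqP: hv; rewrite size_eq0 => /eqP ->.
  (* Beyond the last coefficient the default 0 makes the visit emit nothing. *)
  have e0 : nth 0 cs i = 0 by rewrite nth_default ?hi.
  have [//||c1 e1 h1] := @holds_step_stay _ _ _ _ (Loop (inord i)) None g h.
    by rewrite /= e0 !inordK ?hi //= ltnn.
  exists c1 => //; apply: runs_step e1 _.
  by rewrite /= e0 inordK //; apply: runs_refl.
have im : i < m by rewrite -hi /= -addSnnS leq_addr.
have ea : nth 0 cs i = a by rewrite -[i]addn0 -nth_drop hl.
have hl' : drop i.+1 cs = l by rewrite -addn1 addnC -drop_drop hl /= drop0.
have ha : a <= B.
  by rewrite -(cat_take_drop i cs) sumn_cat hl /=; lia.
rewrite /= in hv; rewrite -(cat_take_drop a v) -catA.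
have [||c1 r1 h1] :=
  @run_emit (inord i) a c (drop a v ++ g) w pos (take a v) ha.
- by rewrite size_takel // hv leq_addr.
- by rewrite -ea.
have [//||c2 e2 h2] :=
  @holds_step _ _ _ _ (Loop (inord i.+1)) None i.+1 MoveLeft (drop a v ++ g) h1.
  by rewrite /= !inordK //= ?im // ltnW.
have e2' : g_step (c1, drop a v ++ g) = (c2, drop a v ++ g).
  by rewrite e2 /= inordK.
have {}h2 : holds c2 (Loop (inord i.+1)) (push_guess w (take a v))
    (upd pos i.+1 (before n)).
  apply: holds_ext h2 => j k; rewrite /upd;
    case: eqP => //= _; rewrite hpos //=.
  by rewrite subnn.
(* Induction on the passes left: each uses up [total l] guesses, and the final [n.+2] steps are the
   rewinding. *)
have loop k : k <= n -> forall c u w g, size u = k * total l ->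
    holds c (Loop (inord i.+1)) w (upd pos i.+1 (before k)) ->
    exists2 c', runs c (u ++ g) (k * (visit_time l).+1 + n.+2) c' g &
      holds c' (Loop (inord i)) (push_guess w u) pos.
  elim: k => [|k IHk] hk c0 u w0 g0 hu hc.
    move/eqP: hu; rewrite size_eq0 => /eqP ->.
    have hcur := holds_cur (inord i.+1) hc;
      rewrite inordK // /upd eqxx /= in hcur.
    have [//||c3 e3 h3] :=
      @holds_step _ _ _ _ (Rewind (inord i.+1)) None i.+1 MoveRight g0 hc.
      by rewrite /= hcur inordK.
    have [//|//|//||c4 r4 h4] := @run_rewind i.+1 c3 g0 w0 pos 0 n.
      apply: holds_ext h3 => j q; rewrite /upd;
        case: eqP => //= _; rewrite eqxx //=.
        exact: same_cells_blank.
      by rewrite subn0.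
    exists c4; first exact: runs_step e3 r4.
    by apply: holds_ext h4 => j q; rewrite /upd;
      case: eqP => // ->; rewrite hpos.
  have hcur := holds_cur (inord i.+1) hc;
    rewrite inordK // /upd eqxx /= in hcur.
  rewrite mulSn in hu; rewrite -(cat_take_drop (total l) u) -catA.
  have [//||c3 e3 h3] := @holds_step _ _ _ _ (enter i.+1) None i.+1 MoveLeft
     (take (total l) u ++ drop (total l) u ++ g0) hc.
    by rewrite /= hcur inordK.
  have [||||c4 r4 h4] := IH i.+1 c3 (drop (total l) u ++ g0) w0
    (upd pos i.+1 (before k)) (take (total l) u) _ hl'.
  - by rewrite addSnnS.
  - by move=> j hj; rewrite /upd gtn_eqF // hpos // ltnW.
  - by rewrite size_takel // hu leq_addr.
  - apply: holds_ext h3 => j q; rewrite /upd;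
      case: eqP => //= _; rewrite eqxx //=.
    by rewrite -[_ :: nseq _ _]/(nseq (n - k.+1).+1 mk) -subSn // subSS.
  have [|c5 r5 h5] := IHk (ltnW hk) c4 (drop (total l) u) _ g0 _ h4.
    by rewrite size_drop hu; lia.
  exists c5; last by rewrite /push_guess foldl_cat.
  rewrite mulSn -addnA addSn; apply: runs_step e3 _.
  exact: runs_trans r4 r5.
have [|c3 r3 h3] := loop n (leqnn n) c2 (drop a v) _ g _ h2.
  by rewrite size_drop hv; lia.
exists c3; last by rewrite /push_guess foldl_cat.
apply: runs_leq (runs_trans r1 (runs_step e2' r3)) => /=; lia.
Qed.

End Visit.

Lemma run_copy x c g w k :
  cstate c = Copy -> fwd (ctapes c (inl false)) x ->
  bwd (ctapes c (inl true)) w ->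
  (forall j, tape_at (ctapes c (inr j)) (nseq k (bit true)) [::]) ->
  exists2 c', runs c g (size x).+1 c' g &
    holds c' (enter 0) (true :: catrev x w) (fun _ => rest (k + size x)).
Proof.
elim: x c w k => [|a x IH] c w k hs hi hq hl.
  exists (g_step (c, g)).1.
    by exists 1 => //=; rewrite hs /=; case: (scanned c _) => [[]|].
  have hcur : scanned c (inl false) = None by rewrite ffunE (fwd_cur hi).
  rewrite /= hs /= hcur /=; split=> //= [|j]; rewrite !ffunE /=.
    exact: bwd_put.
  by rewrite ffunE tape_write_cur addn0 if_same; apply: hl.
have hcur : scanned c (inl false) = bit a by rewrite ffunE (fwd_cur hi).
have [||||c' r' h'] := IH (g_step (c, g)).1 (a :: w) k.+1;
  rewrite /= ?hs /= ?hcur //=.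
- by rewrite !ffunE; apply: (fwd_right hi).
- by rewrite !ffunE; apply: bwd_put.
- move=> j; rewrite !ffunE /=.
  exact: tape_at_right (tape_at_write (bit true) (hl j)).
exists c'; last by rewrite addnS -addSn.
by apply: runs_step r'; rewrite /g_step hs /= hcur.
Qed.

(** * From computation paths to queries *)

Definition ask_time (x : seq bool) :=
  (size x).+1 + (visit_time (size x) cs + 1).

Lemma run_ask x v g :
  size v = total (size x) cs ->
  exists2 c, runs (ntm_init GM x) (v ++ g) (ask_time x) c g &
    (cstate c : gstate) = Ask /\ query_word c = query x v.
Proof.
move=> hv.
have [//||||c1 r1 h1] := @run_copy x (ntm_init GM x) (v ++ g) [::] 0.
- by rewrite ffunE; exists [::]; apply: tape_at_tape_of.
- rewrite ffunE; apply: tape_at_eq (tape_at_tape_of _ _) => // -[|k] //=.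
  by rewrite nth_nil.
- by move=> j; rewrite ffunE; apply: tape_at_tape_of.
have [//||//|c2 r2 [hs hq _]] := run_visit (l := cs) (i := 0) g _ _ _ hv h1.
  by rewrite drop0.
exists (g_step (c2, g)).1.
  apply: runs_trans r1 (runs_trans r2 _); exists 1 => //=.
  by rewrite hs /= inordK.
rewrite /= hs /= inordK //=; split=> //.
(* The step into [Ask] moves the query head right, from the blank to the first letter, where
   [query_word] starts. *)
rewrite /query_word /= !ffunE; exact: tape_word_at (tape_at_right hq).
Qed.

Lemma g_step_ask c g k :
  (cstate c : gstate) = Ask -> iter k g_step (c, g) = (c, g).
Proof.
move=> hs; elim: k => // k IH; rewrite iterS IH /g_step hs.
by case: (g_trans _ _ _).
Qed.

Lemma live_step A c c' : ntm_step A c c' -> live c.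
Proof.
case=> [q w ha hq /andP[hr _]|ha hq _|ha hq _]; split=> h.
- by move: ha; rewrite h eqxx.
- by move: hr; rewrite h eqxx.
- by rewrite h in hq.
- by rewrite h in hq.
- by rewrite h in hq.
- by rewrite h in hq.
Qed.

(** Padding the guesses of a path with zeros gives a full word [v], whose determinized run reaches
    [Ask] at some time [t] and stays there. A live path following the same guesses is either shorter
    than [t] or already at that configuration. *)
Lemma live_steps_ask A x k c :
  ntm_steps A (ntm_init GM x) k c -> live c ->
  exists2 v, size v = total (size x) cs &
  exists c' : cfg, [/\ (cstate c' : gstate) = Ask, query_word c' = query x v &
    exists2 t, t <= ask_time x &
      (k < t \/ c = c') /\ ((cstate c : gstate) = Ask -> c = c')].
Proof.
move=> st lv; have [g hg] := steps_g_run st lv.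
set P := total (size x) cs.
have {}hg := hg (nseq P false); set gg := g ++ nseq P false in hg.
have hsz : P <= size gg by rewrite size_cat size_nseq leq_addl.
exists (take P gg); first by rewrite size_takel.
have [|c' [t ht e] [hs hw]] := @run_ask x (take P gg) (drop P gg).
  by rewrite size_takel.
exists c'; split=> //; exists t => //; rewrite cat_take_drop in e.
have late : t <= k -> c = c'.
  by move=> h; move: hg; rewrite -(subnK h) iterD e g_step_ask // => -[].
split; first by case: (leqP t k) => h; [right; apply: late | left].
move=> ha; case: (leqP t k) => [/late //|/ltnW h].
by move: e; rewrite -(subnK h) iterD hg g_step_ask // => -[].
Qed.

(** Leaving [Ask] leads to an answer state, so the predecessor of a live configuration still
    precedes the query. *)
Lemma live_steps_time A x k c :
  ntm_steps A (ntm_init GM x) k c -> live c -> k <= ask_time x.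
Proof.
case=> // {}k c1 c2 st1 st2 lv2.
have [v _ [c' [hs _ [t ht [[h|h] _]]]]] := live_steps_ask st1 (live_step st2).
  exact: leq_trans ht.
rewrite -h in hs; case: st2 lv2 => [q w _ hq _|_ _ _|_ _ _] [] // _ _.
by move: hq; rewrite hs eqxx.
Qed.

Lemma steps_time A x k c :
  ntm_steps A (ntm_init GM x) k c -> k <= (ask_time x).+1.
Proof.
by case=> // {}k c1 c2 st1 /live_step; rewrite ltnS; apply: live_steps_time st1.
Qed.

Lemma accepts_query A x :
  ntm_accepts GM A x <->
  exists2 v, size v = total (size x) cs & A (query x v).
Proof.
split.
  case=> k [c [st hc]]; case: st hc => [|{}k c1 c2 st1 st2] hc //.
  have [v hv [c' [hs hw [t ht [_ h]]]]] := live_steps_ask st1 (live_step st2).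
  exists v => //; rewrite -hw.
  case: st2 hc h => [q w ha _ /andP[_ /existsP[b /eqP e]]|_ ha hA|//] hc h.
    by move: ha; rewrite (@g_trans_accept (cstate c1) (scanned c1) b) ?eqxx ?e.
  by rewrite -h.
case=> v hv hA; have [c [k _ e] [hs hw]] := run_ask [::] hv.
have [|j st] := g_run_steps A e; first by split; rewrite hs.
exists j.+1, (Config (Accept : ntm_state GM) (ctapes c)); split=> //.
apply: StepsS st _; apply: StepYes => //; rewrite ?hw //.
by apply/eqP; rewrite hs.
Qed.

End GuessingMachine.

(** * Polynomial bounds and the final assembly *)

Lemma total_horner (p : {poly nat}) n : total n p = p.[n]%R.
Proof.
by rewrite /horner; elim: (polyseq p) => //= a l ->; rewrite addnC mulnC.
Qed.

Fixpoint visit_poly (l : seq nat) : {poly nat} :=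
  (if l is a :: l' then (2 * a + 3)%N%:P + (visit_poly l' + 2%:P) * 'X
   else 1%:P)%R.

Lemma visit_polyE l n : (visit_poly l).[n]%R = visit_time n l.
Proof.
elim: l => [|a l IH]; first by rewrite /= hornerC.
rewrite /= hornerD hornerMX hornerD !hornerC IH.
by rewrite -[LHS]/(2 * a + 3 + (visit_time n l + 2) * n)%N [_ * n]mulnC.
Qed.

Theorem theorem4 (L : language) : PP L -> NP_oracle MNS L.
Proof.
case=> p [R [[M [time hM]] hL]].
(* A witness has one bit per letter of the query and four tag bits. *)
pose p' : {poly nat} := ('X + 4%:P)%R.
exists (fun q => exists2 t, 1 <= t &
          num_witnesses p' (oracle_rel R) q = 2 ^ t - 1).
  exists p', (oracle_rel R); split=> //.
  exists (oracle_machine M), ('X + 7%:P + time)%R.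
  exact: oracle_machine_decides.
(* Here [p] is read as its coefficient list, constant term first. The 3 counts the step writing the
   separator, the step into [Ask] and the oracle's answer. *)
exists (guessing_machine p), ('X + visit_poly p + 3%:P)%R => x; split.
  move=> n c /steps_time h; apply: leq_trans h _.
  rewrite /ask_time !hornerD hornerX hornerC visit_polyE.
  rewrite -[leqRHS]/(size x + visit_time (size x) p + 3)%N; lia.
rewrite accepts_query total_horner hL /num_witnesses card_tuple_cnt.
have count v : size v = p.[size x]%R ->
    (exists2 t, 1 <= t &
       num_witnesses p' (oracle_rel R) (query x v) = 2 ^ t - 1) <->
    2 * cnt p.[size x]%R (R x) + rank v = 2 * 2 ^ p.[size x]%R.
  move=> hv; rewrite -query_count_criterion ?cnt_le // -?hv ?rank_lt //.
  have e : p'.[size (query x v)]%R = (size (query x v)).+4.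
    by rewrite hornerD hornerX hornerC -[LHS]/(_ + 4)%N addn4.
  by rewrite /num_witnesses card_tuple_cnt e cnt_oracle_rel.
have hN := cnt_le p.[size x]%R (R x).
split=> [h|[v hv /count - /(_ hv) e]]; last first.
  by have := rank_lt v; rewrite hv; lia.
(* The subtraction does not truncate since N is at most [2 ^ P], and the majority condition puts the
   difference below [2 ^ P], so some guess has this rank. *)
have [|v hv hr] := @rank_surj p.[size x]%R
  (2 * 2 ^ p.[size x]%R - 2 * cnt p.[size x]%R (R x)).
  by lia.
by exists v => //; apply/count => //; lia.
Qed.
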